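(* Let $n\ge 1$ be an integer, let $f$ be either of the functionals $\phi^t,\phi^l$ on $\mathcal{C}^n$, and let $C_0$ be an $n$-dimensional centrally symmetric convex body. Then, for any $C\in\mathcal{C}^n$, we have $$f(C)\le e^{\|C,C_0\|}f(C_0),$$ where $\|\cdot\|$ is the Banach-Mazur metric.
   Context: An $n$-dimensional convex body is a compact convex subset of Euclidean space $\mathbb{E}^n$ with nonempty interior; $\mathcal{C}^n$ is the family of all centrally symmetric ones. Let $\mathcal{T}^n$ be the family of all nonsingular affine linear transformations from $\mathbb{E}^n$ to $\mathbb{E}^n$. The Banach-Mazur metric is $$\|K_1,K_2\|=\log\min\{r:\ K_1\subseteq\sigma(K_2)\subseteq rK_1+\mathbf{x};\ \mathbf{x}\in\mathbb{E}^n;\ \sigma\in\mathcal{T}^n\},$$ with $\log$ the natural logarithm. Packing-covering constants. For a discrete set $X\subset\mathbb{E}^n$, let $\rho(C,X)$ be the largest number $\rho$ such that $\rho C+X$ (the family of translates $\rho C+\mathbf{x}$, $\mathbf{x}\in X$) is a packing, i.e. its members have pairwise disjoint interiors, and let $\rho'(C,X)$ be the smallest number $\rho'$ such that $\rho'C+X$ is a covering of $\mathbb{E}^n$. The translative packing-covering constant $\phi^t(C)$ is the minimum (infimum) of $\rho'(C,X)/\rho(C,X)$ over all discrete sets $X$ (for which $\rho(C,X)>0$ and $\rho'(C,X)<\infty$), and the lattice packing-covering constant is $\phi^l(C)=\min_\Lambda\rho'(C,\Lambda)/\rho(C,\Lambda)$, over all full-rank lattices $\Lambda$ in $\mathbb{E}^n$.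 *)

(* Defs.v *)
(* Euclidean n-space over R : realType is 'rV[R]_n; its
   library topology, induced by the max norm, is the Euclidean one. *)
From HB Require Import structures.
From mathcomp Require Import all_boot all_order all_algebra.
From mathcomp Require Import all_classical all_reals all_analysis.

Set Implicit Arguments.
Unset Strict Implicit.
Unset Printing Implicit Defensive.

Import Order.TTheory GRing.Theory Num.Theory.
Import numFieldNormedType.Exports.

Local Open Scope classical_set_scope.
Local Open Scope ring_scope.

Section ConvexBodies.
Variables (R : realType) (n : nat).
Implicit Types (C K : set 'rV[R]_n) (X : set 'rV[R]_n).

Definition convex_body C : Prop :=
  [/\ compact C, convex_set C & interior C !=set0].

(* The centre c need not be the origin. *)
Definition centrally_symmetric C : Prop :=
  exists c : 'rV[R]_n, forall x, C x -> C (c *+ 2 - x).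

Definition symmetric_convex_body C : Prop :=
  convex_body C /\ centrally_symmetric C.

(* r C + x *)
Definition scaled_translate (r : R) C (x : 'rV[R]_n) : set 'rV[R]_n :=
  [set r *: y + x | y in C].

Definition nonsingular_affine (s : 'rV[R]_n -> 'rV[R]_n) : Prop :=
  exists (A : 'M[R]_n) (b : 'rV[R]_n),
    A \in unitmx /\ forall x, s x = x *m A + b.

(* Only r > 0 is admitted: for centrally symmetric bodies r K1 and - r K1 are
   translates of each other, so over all real r the set below would be
   unbounded from below and have no minimum. *)
Definition banach_mazur_ratios K1 K2 : set R :=
  [set r | 0 < r /\ exists (x : 'rV[R]_n) (s : 'rV[R]_n -> 'rV[R]_n),
    [/\ nonsingular_affine s, K1 `<=` s @` K2
      & s @` K2 `<=` scaled_translate r K1 x]].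

Definition banach_mazur K1 K2 : R := ln (inf (banach_mazur_ratios K1 K2)).

Definition is_packing (r : R) C X : Prop :=
  trivIset X (fun x => interior (scaled_translate r C x)).

Definition is_covering (r : R) C X : Prop :=
  \bigcup_(x in X) scaled_translate r C x = setT.

(* Both constants are taken over r >= 0; packing_radius is +oo when there is
   no largest r (X has at most one point), and covering_radius is +oo when no
   r gives a covering. *)
Definition packing_radius C X : \bar R :=
  ereal_sup [set r%:E | r in [set r : R | 0 <= r /\ is_packing r C X]].

Definition covering_radius C X : \bar R :=
  ereal_inf [set r%:E | r in [set r : R | 0 <= r /\ is_covering r C X]].

Definition packing_covering_ratio C X : \bar R :=
  (covering_radius C X / packing_radius C X)%E.

Definition discrete_subset X : Prop := X `<=` isolated X.

(* The integer span of the rows of an invertible matrix. *)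
Definition full_rank_lattice X : Prop :=
  exists2 B : 'M[R]_n, B \in unitmx &
    X = range (fun z : 'rV[int]_n => map_mx intr z *m B).

Definition translative_packing_covering C : \bar R :=
  ereal_inf [set packing_covering_ratio C X | X in
    [set X | [/\ discrete_subset X, (0 < packing_radius C X)%E
               & (covering_radius C X < +oo)%E]]].

Definition lattice_packing_covering C : \bar R :=
  ereal_inf [set packing_covering_ratio C X | X in full_rank_lattice].

End ConvexBodies.

(* Main.v *)
(* If [C] lies inside [s C0] and [s C0] inside a translate of [r C], with [s]
   affine of linear part [A], then for every [X] a packing [rho C0 + X] yields
   the packing [rho C + X A], and a covering [rho C0 + X] yields the covering
   [r rho C + X A]: the translation parts of [s] and of [r C + x] only shift
   the whole family.  Hence the ratio of [C] at [X A] is at most [r] times the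
   ratio of [C0] at [X], and it remains to take the infimum over [X], then
   over [r]. *)
Require Import Defs.
From HB Require Import structures.
From mathcomp Require Import all_boot all_order all_algebra.
From mathcomp Require Import all_classical all_reals all_analysis.
Import Order.TTheory GRing.Theory Num.Theory.
Import numFieldNormedType.Exports.
Local Open Scope classical_set_scope.
Local Open Scope ring_scope.

Set Implicit Arguments.
Unset Strict Implicit.

(** * Topology of affine maps and of points *)

Lemma affine_continuous (R : realType) (m n : nat) (A : 'M[R]_(m, n))
  (b : 'rV[R]_n) : continuous (fun x : 'rV[R]_m => x *m A + b).
Proof.
suff cA : continuous (mulmx^~ A : 'rV[R]_m -> 'rV[R]_n).
  move=> x; apply: (@continuousD _ 'rV[R]_n 'rV[R]_m (mulmx^~ A) (fun=> b)).
    exact: cA.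
  exact: cst_continuous.
have -> : mulmx^~ A = fun x : 'rV[R]_m => \sum_i x 0 i *: row i A.
  by apply/funext => x; rewrite mulmx_sum_row.
apply: (@continuous_big 'rV[R]_n _ +%R 0 xpredT add_continuous) => i _ y.
by apply: continuousZr_tmp; exact: coord_continuous.
Qed.

(** The line through [y] in direction [(1, ..., 1)] is continuous and meets [[set y]] only at
    parameter [0], so an interior point would make [[set 0]] a neighbourhood of [0] in [R]. Positive
    dimension supplies the coordinate that recovers the parameter. *)
Lemma interior_set1_rV (R : realType) (n : nat) (hn : (1 <= n)%N)
  (y : 'rV[R]_n) : interior [set y] = set0.
Proof.
rewrite -subset0 => z zi; have /= zy := interior_subset zi.
rewrite {}zy in zi; pose g t : 'rV[R]_n := t *: const_mx 1 + y.
have g0 : g 0 = y by rewrite /g scale0r add0r.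
have gc : {for 0, continuous g}.
  apply: (@continuousD _ 'rV[R]_n R ( *:%R^~ (const_mx 1)) (fun=> y)).
    by apply: continuousZr_tmp; exact: cvg_id.
  exact: cst_continuous.
have := gc [set y]; rewrite g0 => /(_ zi) H.
suff : (interior [set 0 : R]) 0 by rewrite interior_set1.
have sub : g @^-1` [set y] `<=` [set 0].
  move=> t /= /(congr1 (fun M : 'rV_n => M 0 (Ordinal hn))).
  by rewrite !mxE mulr1 -[RHS]add0r => /addIr.
exact: (interiorS sub) H.
Qed.

(** * Packing and covering radii under affine inclusions *)

Section RadiiUnderInclusions.
Variables (R : realType) (n : nat).
Implicit Types (C K X : set 'rV[R]_n) (A : 'M[R]_n).

Lemma packing_affine C K X A b rho : A \in unitmx ->
  C `<=` (fun x => x *m A + b) @` K ->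
  is_packing rho K X -> is_packing rho C (mulmx^~ A @` X).
Proof.
move=> uA CK pK.
(* The shift [rho *: b] is the same for every [i], so a common interior point of two translates of
   [C] pulls back to one of the corresponding translates of [K]. *)
have pull i z : interior (scaled_translate rho C (i *m A)) z ->
    interior (scaled_translate rho K i) ((z - rho *: b) *m invmx A).
  move=> zi; set w := _ *m invmx A.
  have wz : w *m A + rho *: b = z by rewrite mulmxKV // subrK.
  have := @affine_continuous R n n A (rho *: b) w _.
  rewrite wz => /(_ _ zi); apply: interiorS => v /= [y Cy yv].
  have [k Kk kE] := CK _ Cy; exists k => //.
  apply: (can_inj (mulmxK uA)); apply: (addIr (rho *: b)).
  by rewrite -yv -kE mulmxDl scalerDr -scalemxAl addrAC.
move=> _ _ [i Xi <-] [j Xj <-] [z [zi zj]].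
by congr (_ *m A); apply: pK => //; exists ((z - rho *: b) *m invmx A);
  split; exact: pull.
Qed.

Lemma covering_affine C K X A b r x rho : A \in unitmx ->
  (fun x => x *m A + b) @` K `<=` scaled_translate r C x ->
  is_covering rho K X -> is_covering (r * rho) C (mulmx^~ A @` X).
Proof.
move=> uA KC cK; rewrite /is_covering -subTset => z _.
(* Chosen so that [w *m A + rho *: b = z + rho *: x]: writing [w = rho *: k + i] and
   [k *m A + b = r *: y + x], both shifts cancel and [z = (r * rho) *: y + i *m A]. *)
pose w := (z + rho *: x - rho *: b) *m invmx A.
have : setT w by [].
rewrite -cK => -[i Xi [k Kk kw]].
have [y Cy yE] : scaled_translate r C x (k *m A + b) by apply: KC; exists k.
exists (i *m A); first by exists i.
exists y => //; apply: (addIr (rho *: x)).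
rewrite addrAC mulrC -scalerA -scalerDr yE.
have -> : z + rho *: x = w *m A + rho *: b by rewrite mulmxKV // subrK.
by rewrite -kw mulmxDl scalerDr -scalemxAl addrAC.
Qed.

Lemma le_packing_radius_affine C K X A b : A \in unitmx ->
  C `<=` (fun x => x *m A + b) @` K ->
  (packing_radius K X <= packing_radius C (mulmx^~ A @` X))%E.
Proof.
move=> uA CK; apply: ereal_sup_le => _ [rho [rho0 p] <-].
by exists rho => //; split=> //; exact: packing_affine uA CK p.
Qed.

Lemma le_covering_radius_affine C K X A b r x : 0 < r -> A \in unitmx ->
  (fun x => x *m A + b) @` K `<=` scaled_translate r C x ->
  (covering_radius C (mulmx^~ A @` X) <= r%:E * covering_radius K X)%E.
Proof.
move=> r0 uA KC; rewrite -lee_pdivrMl //.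
apply: le_ereal_inf_tmp => _ [rho [rho0 c] <-].
rewrite lee_pdivrMl // -EFinM; apply: ereal_inf_lbound.
exists (r * rho) => //; split; first by rewrite mulr_ge0 // ltW.
exact: covering_affine uA KC c.
Qed.

(** The factor [0] always gives a packing: each translate lies in a single point, whose interior is
    empty. *)
Lemma packing_radius_ge0 C X : (1 <= n)%N -> (0 <= packing_radius C X)%E.
Proof.
move=> hn; apply: ereal_sup_ubound; exists 0 => //; split=> //.
have sub x : interior (scaled_translate 0 C x) `<=` set0.
  rewrite -(@interior_set1_rV R n hn x); apply: interiorS => _ [y _ <-] /=.
  by rewrite scale0r add0r.
by move=> i j _ _ [z [/sub]].
Qed.

Lemma covering_radius_ge0 C X : (0 <= covering_radius C X)%E.
Proof. by apply: le_ereal_inf_tmp => _ [rho [rho0 _] <-]; rewrite lee_fin. Qed.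

Lemma packing_covering_ratio_ge0 C X : (1 <= n)%N ->
  (0 <= packing_covering_ratio C X)%E.
Proof.
move=> hn; apply: mule_ge0; first exact: covering_radius_ge0.
by rewrite inve_ge0; exact: packing_radius_ge0.
Qed.

Lemma le_packing_covering_ratio_affine C K X A b r x : (1 <= n)%N -> 0 < r ->
  A \in unitmx -> C `<=` (fun x => x *m A + b) @` K ->
  (fun x => x *m A + b) @` K `<=` scaled_translate r C x ->
  (packing_covering_ratio C (mulmx^~ A @` X)
     <= r%:E * packing_covering_ratio K X)%E.
Proof.
move=> hn r0 uA CK KC; rewrite /packing_covering_ratio muleA.
apply: lee_pmul.
- exact: covering_radius_ge0.
- by rewrite inve_ge0; exact: packing_radius_ge0.
- exact: (le_covering_radius_affine X r0 uA KC).
(* Inversion is antitone on all of [[0, +oo]], so zero or infinite packing radii need no separate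
   case. *)
- by rewrite lee_pV2 ?inE ?packing_radius_ge0 //;
    exact: (le_packing_radius_affine X uA CK).
Qed.

Lemma discrete_subset_mulmx X A : A \in unitmx ->
  discrete_subset X -> discrete_subset (mulmx^~ A @` X).
Proof.
move=> uA dX _ [x Xx <-]; have [_ [V Vx VX]] := dX _ Xx.
split; first by rewrite inE; exists x.
(* An isolating neighbourhood of [x] is transported by the inverse map; [+ 0] only matches the form
   in [affine_continuous]. *)
exists [set y | V (y *m invmx A + 0)].
  apply: (@affine_continuous R n n (invmx A) 0 (x *m A)).
  by rewrite mulmxK // addr0.
apply/seteqP; split=> [z [/= Vz [y Xy yz]]|_ ->].
  rewrite -yz mulmxK // addr0 in Vz *.
  by have : (V `&` X) y by []; rewrite VX => ->.
have [Vx' _] : (V `&` X) x by rewrite VX.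
by split; [rewrite /= mulmxK // addr0 | exists x].
Qed.

Lemma full_rank_lattice_mulmx X A : A \in unitmx ->
  full_rank_lattice X -> full_rank_lattice (mulmx^~ A @` X).
Proof.
move=> uA [B uB ->]; exists (B *m A); first by rewrite unitmx_mul uB.
rewrite image_comp; congr (_ @` _); apply/funext => z /=.
by rewrite mulmxA.
Qed.

End RadiiUnderInclusions.

(** * The two functionals compared for a fixed ratio *)

Section Functionals.
Variables (R : realType) (n : nat) (hn : (1 <= n)%N).
Implicit Types C K : set 'rV[R]_n.

(** Admissibility passes from [X] to its image: discreteness by invertibility of [A], the conditions
    on the two radii by their comparison under the inclusions. *)
Lemma le_translative_packing_covering C K r : banach_mazur_ratios C K r ->
  (translative_packing_covering C <= r%:E * translative_packing_covering K)%E.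
Proof.
move=> [r0 [x [s [[A [b [uA sE]]]]]]].
have -> : s = fun x => x *m A + b by apply/funext.
move=> CK KC; rewrite -lee_pdivrMl //.
apply: le_ereal_inf_tmp => _ [X [dX pX cX] <-]; rewrite lee_pdivrMl //.
apply: le_trans (le_packing_covering_ratio_affine X hn r0 uA CK KC).
apply: ereal_inf_lbound; exists (mulmx^~ A @` X) => //; split.
- exact: discrete_subset_mulmx.
- exact: lt_le_trans pX (le_packing_radius_affine X uA CK).
- apply: le_lt_trans (le_covering_radius_affine X r0 uA KC) _.
  by rewrite lte_mul_pinfty // ?lee_fin ?ltW.
Qed.

Lemma le_lattice_packing_covering C K r : banach_mazur_ratios C K r ->
  (lattice_packing_covering C <= r%:E * lattice_packing_covering K)%E.
Proof.
move=> [r0 [x [s [[A [b [uA sE]]]]]]].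
have -> : s = fun x => x *m A + b by apply/funext.
move=> CK KC; rewrite -lee_pdivrMl //.
apply: le_ereal_inf_tmp => _ [X lX <-]; rewrite lee_pdivrMl //.
apply: le_trans (le_packing_covering_ratio_affine X hn r0 uA CK KC).
apply: ereal_inf_lbound; exists (mulmx^~ A @` X) => //.
exact: full_rank_lattice_mulmx.
Qed.

End Functionals.

(** * Existence of ratios and passage to their infimum *)

Lemma convex_body_sub_ball (R : realType) (n : nat) (C : set 'rV[R]_n)
  (c : 'rV[R]_n) : convex_body C ->
  exists2 M, 0 < M & forall x, C x -> `|x - c| < M.
Proof.
move=> [/compact_bounded [M [_ bound]] _ _].
have lt_M : M < `|M| + 1 by rewrite (le_lt_trans (ler_norm M)) ?ltrDl.
have bM := bound _ lt_M.
exists (`|M| + 1 + `|c| + 1) => [|x Cx].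
  by rewrite addr_gt0 // ltr_wpDr // addr_ge0.
rewrite (le_lt_trans (ler_normB x c)) // -addrA ler_ltD //; first exact: bM.
by rewrite ltrDl.
Qed.

Lemma convex_body_sup_ball (R : realType) (n : nat) (C : set 'rV[R]_n) :
  convex_body C ->
  exists c, exists2 e, 0 < e & forall x, `|x - c| < e -> C x.
Proof.
move=> [_ _ [c]] /nbhs_ballP [e e0 eC]; exists c; exists e => // x xc.
by apply: eC; rewrite -ball_normE /= distrC.
Qed.

(** Inner and outer balls suffice: [t] enlarges the inner ball of [K] to the outer ball of [C], and
    [r] enlarges the inner ball of [C] to the outer ball of the dilated [K]. Both maps are
    homotheties, arranged about [c]. Thus the infimum is taken over a nonempty set. *)
Lemma banach_mazur_ratios_nonempty (R : realType) (n : nat)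
  (C K : set 'rV[R]_n) : convex_body C -> convex_body K ->
  banach_mazur_ratios C K !=set0.
Proof.
move=> bC bK.
have [c [e e0 eC]] := convex_body_sup_ball bC.
have [k [d d0 dK]] := convex_body_sup_ball bK.
have [M M0 CM] := convex_body_sub_ball c bC.
have [N N0 KN] := convex_body_sub_ball k bK.
pose t := M / d; have t0 : 0 < t by rewrite divr_gt0.
pose r := t * N / e; have r0 : 0 < r by rewrite divr_gt0 // mulr_gt0.
exists r; split=> //; exists (c - r *: c).
exists (fun x => x *m t%:M + (c - t *: k)); split.
- exists t%:M, (c - t *: k); split=> //.
  by rewrite unitmxE det_scalar unitrX // unitfE gt_eqF.
- move=> x Cx; exists (t^-1 *: (x - c) + k).
    apply: dK; rewrite addrK normrZ gtr0_norm ?invr_gt0 //.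
    by rewrite ltr_pdivrMl // divfK ?gt_eqF // CM.
  rewrite mul_mx_scalar scalerDr scalerA divff ?gt_eqF // scale1r.
  by rewrite addrACA subrK subrr addr0.
- move=> _ [x Kx <-]; rewrite mul_mx_scalar.
  exists ((r^-1 * t) *: (x - k) + c).
    apply: eC; rewrite addrK normrZ gtr0_norm ?mulr_gt0 ?invr_gt0 //.
    rewrite -mulrA ltr_pdivrMl // divfK ?gt_eqF //.
    by rewrite ltr_pM2l // KN.
  rewrite scalerDr scalerA mulrA divff ?gt_eqF // mul1r scalerBr.
  by rewrite [c - r *: c]addrC addrA addrK -addrA [- _ + c]addrC.
Qed.

(* When the infimum is [0], [ln 0 = 0] makes the factor [1]; this junk case is
   harmless because [0 <= y]. *)
Lemma le_expR_banach_mazur (R : realType) (n : nat) (C K : set 'rV[R]_n)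
  (x y : \bar R) : banach_mazur_ratios C K !=set0 -> (0 <= y)%E ->
  (forall r, banach_mazur_ratios C K r -> (x <= r%:E * y)%E) ->
  (x <= (expR (banach_mazur C K))%:E * y)%E.
Proof.
rewrite /banach_mazur; set S := banach_mazur_ratios C K => S0 y0 H.
have Slb : lbound S 0 by move=> r [/ltW].
have infS : has_inf S by split=> //; exists 0.
have le_m : inf S <= expR (ln (inf S)).
  have : 0 <= inf S by exact: lb_le_inf.
  by rewrite le_eqVlt => /orP[/eqP <-|m0]; [exact: expR_ge0|rewrite lnK].
case: y y0 H => [y| |] // y0 H; last first.
  by rewrite gt0_muley ?leey // lte_fin expR_gt0.
apply: le_trans (_ : ((inf S)%:E * y%:E <= _)%E); last first.
  by rewrite lee_wpmul2r // lee_fin.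
apply/lee_addgt0Pr => e e0.
(* The slack costs at most [e] after multiplication by [y]; the [+ 1] keeps the denominator positive
   when [y = 0]. *)
have d0 : 0 < e / (y + 1) by rewrite divr_gt0 // ltr_wpDl.
have [r Sr rm] := inf_adherent d0 infS.
apply: le_trans (H _ Sr) _; rewrite -!EFinM -EFinD lee_fin.
apply: le_trans (ler_wpM2r y0 (ltW rm)) _; rewrite mulrDl lerD2l.
rewrite -mulrA ler_piMr ?ltW // mulrC ltr_pdivrMr ?ltr_wpDl //.
by rewrite mul1r ltrDl.
Qed.

Unset Implicit Arguments.
Set Strict Implicit.

Theorem theorem4 (R : realType) (n : nat) (hn : (1 <= n)%N)
    (f : set 'rV[R]_n -> \bar R)
    (hf : f = @translative_packing_covering R n \/
          f = @lattice_packing_covering R n)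
    (C0 : set 'rV[R]_n) (hC0 : symmetric_convex_body C0)
    (C : set 'rV[R]_n) (hC : symmetric_convex_body C) :
  (f C <= (expR (banach_mazur C C0))%:E * f C0)%E.
Proof.
have S0 := banach_mazur_ratios_nonempty hC.1 hC0.1.
apply: le_expR_banach_mazur => //.
  by case: hf => ->; apply: le_ereal_inf_tmp => _ [X _ <-];
    exact: packing_covering_ratio_ge0.
move=> r; case: hf => ->; first exact: le_translative_packing_covering.
exact: le_lattice_packing_covering.
Qed.
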